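(* For each number $n\in\mathbb N$, the tuple $(\mathsf{OT}^0_{n+1},\iota_n,\vartheta_n)$ is an initial Bachmann-Howard fixed point of the $\mathsf{LO}$-dilator $D_n$ over the empty order $0$, where $D_n(X)=1+\mathsf{OT}^0_n\times X$ and $\iota_n$, $\vartheta_n$ are the functions defined in the context.
   Context: Term systems: for each $n\in\mathbb N$, a set $\mathsf{OT}_n$ of terms is constructed together with, for each $s\in\mathsf{OT}_n$, a number $S(s)\in\{-1,\dots,n-1\}$ and finite sets $K_i(s)\subseteq\mathsf{OT}_n$ for $i\geq-1$: (i) there is a term $\overline 0\in\mathsf{OT}_n$ with $S(\overline 0)=-1$ and $K_i(\overline 0)=\emptyset$; (ii) given $s,t\in\mathsf{OT}_n$ and $i<n$ with $i\geq\max\{S(s)-1,S(t),0\}$ and $K_i(s)=\emptyset$, there is a term $\theta_ist\in\mathsf{OT}_n$ with $S(\theta_ist)=i$, $K_j(\theta_ist)=\{\theta_ist\}$ if $i\leq j$, and $K_j(\theta_ist)=K_j(s)\cup K_j(t)$ otherwise. The relation $r<_{\mathsf{OT}}r'$ on $\mathsf{OT}_n$ holds if and only if one of the following applies: (i') $r=\overline 0$ and $r'\neq\overline 0$; (ii') $r=\theta_ist$ and $r'=\theta_js't'$ with $i<j$; (iii') $r=\theta_ist$ and $r'=\theta_is't'$ (same $i$), and one of the following holds: $s<_{\mathsf{OT}}s'$ and $t<_{\mathsf{OT}}r'$; or $s=s'$ and $t<_{\mathsf{OT}}t'$; or $r<_{\mathsf{OT}}t'$ or $r=t'$ (as terms).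 This is a linear order. Put $\mathsf{OT}^0_n=\{s\in\mathsf{OT}_n\mid S(s)\leq 0\}$ with the restricted order. The dilators $D_n$: for a linear order $X$ put $D_n(X)=\{0\}\cup\{(s,x)\mid s\in\mathsf{OT}^0_n,x\in X\}$, where $0$ is the smallest element and $(s,x)<_{D_n(X)}(s',x')$ holds if and only if $s<_{\mathsf{OT}}s'$, or $s=s'$ and $x<_Xx'$. For an order embedding $f:X\to Y$ put $D_n(f)(0)=0$ and $D_n(f)(s,x)=(s,f(x))$. Put $\operatorname{supp}_X(0)=\emptyset$ and $\operatorname{supp}_X(s,x)=\{x\}$. Functions: define $\mathsf{OT}_n\ni s\mapsto s^+\in\mathsf{OT}_{n+1}$ by $\overline 0^+=\overline 0$ and $(\theta_ist)^+=\theta_{i+1}s^+t^+$. Define $\vartheta_n:D_n(\mathsf{OT}^0_{n+1})\to\mathsf{OT}^0_{n+1}$ by $\vartheta_n(0)=\overline 0$ and $\vartheta_n(s,t)=\theta_0s^+t$. Let $\iota_n:0\to\mathsf{OT}^0_{n+1}$ be the empty function. General notions: $\mathsf{LO}$ is the category of linear orders with order embeddings as morphisms; $[X]^{<\omega}$ is the set of finite subsets of $X$, with $[f]^{<\omega}(a)=\{f(x)\mid x\in a\}$. An $\mathsf{LO}$-dilator consists of a functor $D:\mathsf{LO}\to\mathsf{LO}$ and a natural transformation $\operatorname{supp}^D:D\Rightarrow[\cdot]^{<\omega}$ such that, for any $\mathsf{LO}$-morphism $f:X\to Y$ and $\sigma\in D(Y)$, $\operatorname{supp}^D_Y(\sigma)\subseteq\operatorname{rng}(f)$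 implies $\sigma\in\operatorname{rng}(D(f))$. A Bachmann-Howard fixed point of $D$ over a linear order $X$ consists of a linear order $Z$ and functions $\iota:X\to Z$ and $\vartheta:D(Z)\to Z$ such that: (1) $\iota$ is an order embedding; (2) $\iota(x)<_Z\vartheta(\sigma)$ for all $x\in X$, $\sigma\in D(Z)$; (3) if $\sigma<_{D(Z)}\tau$ and $z<_Z\vartheta(\tau)$ for all $z\in\operatorname{supp}^D_Z(\sigma)$, then $\vartheta(\sigma)<_Z\vartheta(\tau)$; furthermore, $z<_Z\vartheta(\sigma)$ for any $z\in\operatorname{supp}^D_Z(\sigma)$. It is initial if for any Bachmann-Howard fixed point $(Z',\iota',\vartheta')$ of $D$ over $X$ there is a unique order embedding $f:Z\to Z'$ with $f\circ\iota=\iota'$ and $f\circ\vartheta=\vartheta'\circ D(f)$. *)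

(* Defs.v *)
From HB Require Import structures.
From Corelib Require Import RelationClasses.
From mathcomp Require Import all_boot all_order all_algebra finmap.
From mathcomp Require Import zify.
From mathcomp Require Import boolp classical_sets functions cardinality.

Set Implicit Arguments.
Unset Strict Implicit.
Unset Printing Implicit Defensive.

Import Order.TTheory GRing.Theory Num.Theory.

Local Open Scope classical_set_scope.

Record LO := MkLO {
  LO_car :> Type;
  LO_lt : LO_car -> LO_car -> Prop;
  LO_strict : StrictOrder LO_lt;
  LO_total : forall x y : LO_car, LO_lt x y \/ x = y \/ LO_lt y x }.

Notation "x <_LO y" := (LO_lt x y) (at level 70, no associativity).

Definition order_embedding (X Y : LO) (f : X -> Y) : Prop :=
  forall x y : X, x <_LO y <-> f x <_LO f y.

Record LO_mor (X Y : LO) := MkLOMor {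
  LO_fun :> X -> Y;
  LO_funP : order_embedding LO_fun }.

Lemma order_embedding_id (X : LO) : order_embedding (@id X).
Proof. by []. Qed.

Lemma order_embedding_comp (X Y Z : LO) (g : LO_mor Y Z) (f : LO_mor X Y) :
  order_embedding (g \o f).
Proof. by move=> x y /=; rewrite -(LO_funP g) -(LO_funP f). Qed.

Definition LO_id (X : LO) : LO_mor X X := MkLOMor (@order_embedding_id X).

Definition LO_comp (X Y Z : LO) (g : LO_mor Y Z) (f : LO_mor X Y) :
  LO_mor X Z := MkLOMor (order_embedding_comp g f).

Definition void_lt (_ _ : void) : Prop := False.

Lemma void_lt_strict : StrictOrder void_lt.
Proof. by split=> [[]|[]]. Qed.

Lemma void_lt_total (x y : void) : void_lt x y \/ x = y \/ void_lt y x.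
Proof. by case: x. Qed.

Definition LO_empty : LO := MkLO void_lt_strict void_lt_total.

(* A natural transformation from [dil_obj] to the finite-powerset functor is
   given by the three components [dil_supp], [dil_supp_fin], [dil_supp_nat]. *)
Record LO_dilator := MkLODilator {
  dil_obj :> LO -> LO;
  dil_map : forall X Y : LO, LO_mor X Y -> LO_mor (dil_obj X) (dil_obj Y);
  dil_map_id : forall X : LO, dil_map (LO_id X) =1 id;
  dil_map_comp : forall (X Y Z : LO) (g : LO_mor Y Z) (f : LO_mor X Y),
    dil_map (LO_comp g f) =1 dil_map g \o dil_map f;
  dil_supp : forall X : LO, dil_obj X -> set X;
  dil_supp_fin : forall (X : LO) (sigma : dil_obj X),
    finite_set (dil_supp sigma);
  dil_supp_nat : forall (X Y : LO) (f : LO_mor X Y) (sigma : dil_obj X),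
    dil_supp (dil_map f sigma) = f @` dil_supp sigma;
  dil_support : forall (X Y : LO) (f : LO_mor X Y) (sigma : dil_obj Y),
    dil_supp sigma `<=` range f -> range (dil_map f) sigma }.

Record BH_fixed_point (D : LO_dilator) (X Z : LO)
    (iota : X -> Z) (vartheta : D Z -> Z) : Prop := {
  BH_iota : order_embedding iota;
  BH_iota_lt : forall (x : X) (sigma : D Z), iota x <_LO vartheta sigma;
  BH_mono : forall sigma tau : D Z, sigma <_LO tau ->
    (forall z : Z, dil_supp sigma z -> z <_LO vartheta tau) ->
    vartheta sigma <_LO vartheta tau;
  BH_supp_lt : forall (sigma : D Z) (z : Z),
    dil_supp sigma z -> z <_LO vartheta sigma }.

Definition initial_BH_fixed_point (D : LO_dilator) (X Z : LO)
    (iota : X -> Z) (vartheta : D Z -> Z) : Prop :=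
  BH_fixed_point iota vartheta /\
  forall (Z' : LO) (iota' : X -> Z') (vartheta' : D Z' -> Z'),
    BH_fixed_point iota' vartheta' ->
    exists! f : LO_mor Z Z',
      f \o iota = iota' /\ f \o vartheta = vartheta' \o dil_map D f.

(* Raw terms: [term_S], [term_K] and [term_lt] do not depend on [n], so they are defined
   on raw terms, and [OT n] is cut out by the side conditions on [theta]. *)
Inductive term := zero_term | theta (i : nat) (s t : term).

Fixpoint term_encode (r : term) : GenTree.tree unit :=
  match r with
  | zero_term => GenTree.Leaf tt
  | theta i s t => GenTree.Node i [:: term_encode s; term_encode t]
  end.

Fixpoint term_decode (u : GenTree.tree unit) : term :=
  match u with
  | GenTree.Node i [:: u1; u2] => theta i (term_decode u1) (term_decode u2)
  | _ => zero_term
  end.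

Lemma term_encodeK : cancel term_encode term_decode.
Proof. by elim=> //= i s -> t ->. Qed.

HB.instance Definition _ := Countable.copy term (can_type term_encodeK).

Definition term_S (r : term) : int :=
  match r with
  | zero_term => (- 1)%R
  | theta i _ _ => i%:Z
  end.

(* The index ranges over [j >= -1]; values at [j < -1] are never used. *)
Fixpoint term_K (j : int) (r : term) : {fset term} :=
  match r with
  | zero_term => fset0
  | theta i s t =>
      if (i%:Z <= j)%R then [fset theta i s t]%fset
      else (term_K j s `|` term_K j t)%fset
  end.

Fixpoint in_OT (n : nat) (r : term) : bool :=
  match r with
  | zero_term => true
  | theta i s t =>
      [&& in_OT n s, in_OT n t, (i < n)%N,
          (Num.max (Num.max (term_S s - 1) (term_S t)) 0 <= i%:Z)%R
        & term_K i%:Z s == fset0]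
  end.

(* The recursion is on the total size of the two terms, hence the inductive
   predicate is the only relation satisfying the defining equivalence. *)
Inductive term_lt : term -> term -> Prop :=
| lt_zero r' : r' <> zero_term -> term_lt zero_term r'
| lt_index i s t j s' t' : (i < j)%N -> term_lt (theta i s t) (theta j s' t')
| lt_left i s t s' t' : term_lt s s' -> term_lt t (theta i s' t') ->
    term_lt (theta i s t) (theta i s' t')
| lt_right i s t t' : term_lt t t' -> term_lt (theta i s t) (theta i s t')
| lt_sub i s t s' t' : term_lt (theta i s t) t' ->
    term_lt (theta i s t) (theta i s' t')
| lt_sub_eq i s t s' t' : theta i s t = t' ->
    term_lt (theta i s t) (theta i s' t').

Definition OT (n : nat) : Type := {r : term | in_OT n r}.

Definition OT_lt (n : nat) (r r' : OT n) : Prop := term_lt (val r) (val r').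

Lemma in_OT_K_sub (n : nat) (j : int) (r : term) :
  in_OT n r -> {subset term_K j r <= in_OT n}.
Proof.
elim: r => [//|i s IHs t IHt] /= Hr; have /and5P[Hs Ht _ _ _] := Hr.
case: ifP => _ u; first by rewrite inE => /eqP ->.
by rewrite inE => /orP[/(IHs Hs)|/(IHt Ht)].
Qed.

Lemma in_OT_S (n : nat) (r : term) :
  in_OT n r -> (-1 <= term_S r <= n%:Z - 1)%R.
Proof. by case: r => [_|i s t /= /and5P[_ _ Hi _ _]]; rewrite /=; lia. Qed.

Lemma in_OT_theta (n i : nat) (s t : term) : in_OT n (theta i s t) ->
  [/\ in_OT n s, in_OT n t & (term_S t <= i%:Z)%R].
Proof. by move=> /= /and5P[? ? _ H _]; split=> //; lia. Qed.

Lemma term_lt_arg (n i : nat) (s t : term) :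
  in_OT n (theta i s t) -> term_lt t (theta i s t).
Proof.
move=> /in_OT_theta[_ _]; case: t => [|j s' t'] /= H; first exact: lt_zero.
have [lt_ji|le_ij] := ltnP j i; first exact: lt_index.
by have -> : j = i by [lia]; apply: lt_sub_eq.
Qed.

Fixpoint term_size (r : term) : nat :=
  if r is theta _ s t then (term_size s + term_size t).+1 else 0.

Lemma term_lt_trans (n : nat) (r r' r'' : term) :
  in_OT n r -> in_OT n r' -> in_OT n r'' ->
  term_lt r r' -> term_lt r' r'' -> term_lt r r''.
Proof.
have [m] := ubnP (term_size r + term_size r' + term_size r'').
elim: m r r' r'' => // m IH r r' r'' Hm Hr Hr' Hr'' L L'.
case: L' Hm Hr' Hr'' L => {r' r''}.
- by move=> r'' _ _ _ _ L; inversion L.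
- move=> i' s' t' j s'' t'' Hij Hm Hr' Hr'' L.
  by inversion L; subst; first [exact: lt_zero | apply: lt_index; lia].
- move=> i s' t' s'' t'' L1 L2 Hm Hr' Hr'' L.
  have [Hs' Ht' _] := in_OT_theta Hr'; have [Hs'' Ht'' _] := in_OT_theta Hr''.
  have Lr' : term_lt (theta i s' t') (theta i s'' t'') by apply: lt_left.
  inversion L as [r1 ?|i1 s t ? ? ? ?|i1 s t ? ? A B|i1 s t ? A|i1 s t ? ? A
    |i1 s t ? ? A]; subst; move: Hm => /= Hm; first exact: lt_zero.
  + exact: lt_index.
  + have [Hs Ht _] := in_OT_theta Hr.
    apply: lt_left; first by apply: (IH s s') => //=; lia.
    by apply: (IH t (theta i s' t')) => //=; lia.
  + have [Hs Ht _] := in_OT_theta Hr.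
    by apply: lt_left => //; apply: (IH t t') => //=; lia.
  + by apply: (IH _ t') => //=; lia.
  + exact: L2.
- move=> i s' t' t'' L1 Hm Hr' Hr'' L.
  have [Hs' Ht' _] := in_OT_theta Hr'; have [Hs'' Ht'' _] := in_OT_theta Hr''.
  have Lr' : term_lt (theta i s' t') (theta i s' t'') by apply: lt_right.
  inversion L as [r1 ?|i1 s t ? ? ? ?|i1 s t ? ? A B|i1 s t ? A|i1 s t ? ? A
    |i1 s t ? ? A]; subst; move: Hm => /= Hm; first exact: lt_zero.
  + exact: lt_index.
  + have [Hs Ht _] := in_OT_theta Hr.
    by apply: lt_left => //; apply: (IH t (theta i s' t')) => //=; lia.
  + have [Hs Ht _] := in_OT_theta Hr.
    by apply: lt_right => //; apply: (IH t t') => //=; lia.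
  + by apply: lt_sub; apply: (IH _ t') => //=; lia.
  + exact: lt_sub.
- move=> i s' t' s'' t'' L1 Hm Hr' Hr'' L.
  have [Hs'' Ht'' _] := in_OT_theta Hr''.
  have Lt : term_lt r t''.
    by move: Hm => /= Hm; apply: (IH _ (theta i s' t')) => //=; lia.
  inversion L; subst; first [exact: lt_zero | exact: lt_index
    | exact: lt_sub].
- move=> i s' t' s'' t'' E Hm Hr' Hr'' L; subst t''.
  inversion L; subst; first [exact: lt_zero | exact: lt_index
    | exact: lt_sub].
Qed.

Lemma term_lt_irr (n : nat) (r : term) : in_OT n r -> ~ term_lt r r.
Proof.
elim: r => [|i s IHs t IHt] Hr L; first by inversion L.
have [Hs Ht _] := in_OT_theta Hr; have Lt := term_lt_arg Hr.
inversion L as [| ? ? ? ? ? ? A| ? ? ? ? ? A|? ? ? ? A|? ? ? ? ? A|? ? ? ? ? A];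
  subst.
- by rewrite ltnn in A.
- exact: IHs A.
- exact: IHt A.
- by apply: (IHt Ht); exact: (term_lt_trans Ht Hr Ht Lt A).
- by move: Lt; rewrite [X in term_lt _ X]A => /(IHt Ht).
Qed.

Lemma term_lt_total (r r' : term) :
  term_lt r r' \/ r = r' \/ term_lt r' r.
Proof.
have [m] := ubnP (term_size r + term_size r').
elim: m r r' => // m IH [|i s t] [|j s' t'] /= Hm.
- by right; left.
- by left; apply: lt_zero.
- by right; right; apply: lt_zero.
have [?|?|?] := ltngtP i j; [by left; apply: lt_index
  | by right; right; apply: lt_index | subst j].
have [||] := IH s s' _; first by lia.
- move=> Ls; have [|L|[L|L]] := IH t (theta i s' t'); first by move=> /=; lia.
  + by left; apply: lt_left.
  + by right; right; rewrite L; apply: lt_sub_eq.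
  + by right; right; apply: lt_sub.
case=> [Es|Ls].
- subst s'; have [|L|[L|L]] := IH t t'; first by lia.
  + by left; apply: lt_right.
  + by right; left; rewrite L.
  + by right; right; apply: lt_right.
- have [|L|[L|L]] := IH (theta i s t) t'; first by move=> /=; lia.
  + by left; apply: lt_sub.
  + by left; apply: lt_sub_eq.
  + by right; right; apply: lt_left.
Qed.

Definition OT0 (n : nat) : Type := {s : OT n | (term_S (val s) <= 0)%R}.

Definition OT0_lt (n : nat) (s t : OT0 n) : Prop := OT_lt (val s) (val t).

Lemma OT_lt_strict (n : nat) : StrictOrder (@OT_lt n).
Proof.
split; first by move=> [r Hr]; apply: term_lt_irr Hr.
by move=> [r Hr] [r' Hr'] [r'' Hr'']; apply: (term_lt_trans Hr Hr' Hr'').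
Qed.

Lemma OT_lt_total (n : nat) (r r' : OT n) :
  OT_lt r r' \/ r = r' \/ OT_lt r' r.
Proof.
have [|[/val_inj|]] := term_lt_total (val r) (val r').
- by left.
- by right; left.
- by right; right.
Qed.

Lemma OT0_lt_strict (n : nat) : StrictOrder (@OT0_lt n).
Proof.
have [irr tr] := OT_lt_strict n.
by split=> [r|r r' r'']; [apply: irr | apply: tr].
Qed.

Lemma OT0_lt_total (n : nat) (s t : OT0 n) :
  OT0_lt s t \/ s = t \/ OT0_lt t s.
Proof.
have [|[/val_inj|]] := OT_lt_total (val s) (val t).
- by left.
- by right; left.
- by right; right.
Qed.

Definition OT0_LO (n : nat) : LO := MkLO (OT0_lt_strict n) (@OT0_lt_total n).

(* [None] is the least element 0. *)
Definition D_car (n : nat) (X : LO) : Type := option (OT0_LO n * X).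

Definition D_lt (n : nat) (X : LO) (sigma tau : D_car n X) : Prop :=
  match sigma, tau with
  | None, None => False
  | None, Some _ => True
  | Some _, None => False
  | Some (s, x), Some (s', x') => s <_LO s' \/ s = s' /\ x <_LO x'
  end.

Lemma D_lt_strict (n : nat) (X : LO) : StrictOrder (@D_lt n X).
Proof.
have [irr tr] := LO_strict (OT0_LO n); have [irrX trX] := LO_strict X.
split=> [[[s x]|]|[[s x]|] [[s' x']|] [[s'' x'']|]] //=.
- by case=> [/irr|[_ /irrX]].
- case=> [L|[-> L]] [L'|[<- L']]; [left|left|left|right].
  + exact: tr L L'.
  + exact: L.
  + exact: L'.
  + by split=> //; apply: trX L L'.
Qed.

Lemma D_lt_total (n : nat) (X : LO) (sigma tau : D_car n X) :
  D_lt sigma tau \/ sigma = tau \/ D_lt tau sigma.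
Proof.
case: sigma tau => [[s x]|] [[s' x']|] /=; try by [left | right; left | right; right].
have [L|[->|L]] := LO_total s s'; [by left; left| |by right; right; left].
have [L|[->|L]] := LO_total x x'; first by left; right.
- by right; left.
- by right; right; right.
Qed.

Definition D_obj (n : nat) (X : LO) : LO :=
  MkLO (@D_lt_strict n X) (@D_lt_total n X).

Definition D_fun (n : nat) (X Y : LO) (f : X -> Y) (sigma : D_obj n X) :
  D_obj n Y :=
  match sigma with
  | None => None
  | Some (s, x) => Some (s, f x)
  end.

Lemma D_fun_embedding (n : nat) (X Y : LO) (f : LO_mor X Y) :
  order_embedding (@D_fun n X Y f).
Proof.
by case=> [[s x]|] [[s' x']|] //=; rewrite -(LO_funP f).
Qed.

Definition D_map (n : nat) (X Y : LO) (f : LO_mor X Y) :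
  LO_mor (D_obj n X) (D_obj n Y) := MkLOMor (@D_fun_embedding n X Y f).

Definition D_supp (n : nat) (X : LO) (sigma : D_obj n X) : set X :=
  match sigma with
  | None => set0
  | Some (_, x) => [set x]
  end.

Lemma D_map_id (n : nat) (X : LO) : D_map n (LO_id X) =1 id.
Proof. by case=> [[]|]. Qed.

Lemma D_map_comp (n : nat) (X Y Z : LO) (g : LO_mor Y Z) (f : LO_mor X Y) :
  D_map n (LO_comp g f) =1 D_map n g \o D_map n f.
Proof. by case=> [[]|]. Qed.

Lemma D_supp_fin (n : nat) (X : LO) (sigma : D_obj n X) :
  finite_set (D_supp sigma).
Proof. by case: sigma => [[s x]|] /=; [exact: finite_set1|]. Qed.

Lemma D_supp_nat (n : nat) (X Y : LO) (f : LO_mor X Y) (sigma : D_obj n X) :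
  D_supp (D_map n f sigma) = f @` D_supp sigma.
Proof. by case: sigma => [[s x]|] /=; rewrite ?image_set1 ?image_set0. Qed.

Lemma D_support (n : nat) (X Y : LO) (f : LO_mor X Y) (sigma : D_obj n Y) :
  D_supp sigma `<=` range f -> range (D_map n f) sigma.
Proof.
case: sigma => [[s y]|] /= H; last by exists None.
by have [x _ <-] := H y erefl; exists (Some (s, x)).
Qed.

Definition D_dilator (n : nat) : LO_dilator :=
  MkLODilator (@D_map_id n) (@D_map_comp n) (@D_supp_fin n) (@D_supp_nat n)
    (@D_support n).

Fixpoint term_plus (r : term) : term :=
  match r with
  | zero_term => zero_term
  | theta i s t => theta i.+1 (term_plus s) (term_plus t)
  end.

Lemma term_S_plus (r : term) : (term_S (term_plus r) <= term_S r + 1)%R.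
Proof. by case: r => [|i s t] //=; lia. Qed.

Lemma fsetU_eq0_term (A B : {fset term}) :
  ((A `|` B)%fset == fset0) = (A == fset0) && (B == fset0).
Proof.
apply/eqP/andP => [E|[/eqP-> /eqP->]]; last by rewrite fsetU0.
split; rewrite -fsubset0 -E; [exact: fsubsetUl | exact: fsubsetUr].
Qed.

Lemma term_K_plus (j : int) (r : term) :
  (term_K (j + 1) (term_plus r) == fset0) = (term_K j r == fset0).
Proof.
have ne0 (x : term) : ([fset x]%fset == fset0) = false.
  by apply/eqP => /fsetP/(_ x); rewrite !inE eqxx.
elim: r => [|i s IHs t IHt] /=; first by rewrite !eqxx.
have -> : (i.+1%:Z <= j + 1)%R = (i%:Z <= j)%R by lia.
by case: ifP => _; rewrite ?ne0 // !fsetU_eq0_term IHs IHt.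
Qed.

Lemma term_K_neg (r : term) : term_K (- 1) r == fset0.
Proof. by elim: r => [|i s IHs t IHt] //=; rewrite fsetU_eq0_term IHs. Qed.

Lemma in_OT_plus (n : nat) (r : term) : in_OT n r -> in_OT n.+1 (term_plus r).
Proof.
elim: r => [//|i s IHs t IHt] /= /and5P[/IHs-> /IHt-> Hi HS HK] /=.
have -> : (i.+1%:Z = i%:Z + 1)%R by lia.
rewrite term_K_plus HK andbT ltnS Hi /=.
by have := term_S_plus s; have := term_S_plus t; lia.
Qed.

Definition OT_plus (n : nat) (s : OT n) : OT n.+1 :=
  exist _ (term_plus (val s)) (in_OT_plus (valP s)).

Definition OT_zero (n : nat) : OT n := exist _ zero_term isT.

Definition OT0_zero (n : nat) : OT0 n := exist _ (OT_zero n) isT.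

Lemma in_OT_theta0_plus (n : nat) (s : OT0 n) (t : OT0 n.+1) :
  in_OT n.+1 (theta 0 (val (OT_plus (val s))) (val (val t))).
Proof.
have := valP s; have := valP t => /= Ht Hs.
rewrite in_OT_plus ?(valP (val s)) // (valP (val t)) /=.
have := term_K_plus (- 1) (val (val s)); rewrite addNr => ->.
by rewrite term_K_neg andbT; have /= := term_S_plus (val (val s)); lia.
Qed.

Definition OT_theta0_plus (n : nat) (s : OT0 n) (t : OT0 n.+1) : OT n.+1 :=
  exist _ (theta 0 (val (OT_plus (val s))) (val (val t)))
    (in_OT_theta0_plus s t).

Definition theta0_plus (n : nat) (s : OT0 n) (t : OT0 n.+1) : OT0 n.+1 :=
  exist _ (OT_theta0_plus s t) isT.

Definition OT0_iota (n : nat) : LO_empty -> OT0_LO n.+1 :=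
  fun x : void => match x with end.

Definition OT0_vartheta (n : nat) (sigma : D_dilator n (OT0_LO n.+1)) :
  OT0_LO n.+1 :=
  match sigma with
  | None => OT0_zero n.+1
  | Some (s, t) => theta0_plus s t
  end.

(* Main.v *)
Require Import Defs.
From mathcomp Require Import all_boot.
From Corelib Require Import RelationClasses.
From mathcomp Require Import all_algebra finmap zify.
From mathcomp Require Import boolp classical_sets.

(** Since [K_0 s] is empty exactly when no [theta_0] occurs in [s], every
    nonzero element of [OT0 n.+1] is [theta_0 s^+ t] for unique [s] in [OT0 n]
    and [t] in [OT0 n.+1]; hence [OT0 n.+1] is freely generated by the
    vartheta of [D_n], and the embedding into another fixed point is forced by
    recursion.  Each clause in the definition of the order on terms matches an
    axiom of Bachmann-Howard fixed points, so the recursive map is monotone. *)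

Set Implicit Arguments.
Unset Strict Implicit.
Unset Printing Implicit Defensive.

Lemma term_plus_inj : injective term_plus.
Proof.
by elim=> [|i s IHs t IHt] [|j s' t'] //= [-> /IHs-> /IHt->].
Qed.

Lemma term_lt_plus (r r' : term) :
  term_lt r r' -> term_lt (term_plus r) (term_plus r').
Proof.
elim=> {r r'} /=.
- by case=> [//|i s t] _; apply: lt_zero.
- by move=> i s t j s' t' ltij; apply: lt_index.
- by move=> i s t s' t' _ lts _ ltt; apply: lt_left.
- by move=> i s t t' _ ltt; apply: lt_right.
- by move=> i s t s' t' _ ltt; apply: lt_sub.
- by move=> i s t s' t' <-; apply: lt_sub_eq.
Qed.

(** The terms compared in the premises of each rule are again shifts, so induction on the derivation
    works on raw terms, without the side conditions that a detour through linearity would need. *)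
Lemma term_lt_plus_inv (r r' : term) :
  term_lt (term_plus r) (term_plus r') -> term_lt r r'.
Proof.
move Eu: (term_plus r) => u; move Eu': (term_plus r') => u' L.
elim: L r r' Eu Eu' => {u u'}.
- move=> u' nz [|//] [|j s' t'] // _ Eu'; first by case: nz.
  exact: lt_zero.
- move=> i s t j s' t' ltij [|i0 s0 t0] // [|j0 s0' t0'] // [Ei _ _] [Ej _ _].
  by apply: lt_index; rewrite -ltnS Ei Ej.
- move=> i s t s' t' _ IHs _ IHt [|i0 s0 t0] // [|j0 s0' t0'] //.
  move=> [Ei Es Et] [Ej Es' Et']; have Eij : j0 = i0 by lia.
  subst; apply: lt_left; first exact: IHs.
  by apply: IHt => //=; rewrite Ej.
- move=> i s t t' _ IHt [|i0 s0 t0] // [|j0 s0' t0'] //.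
  move=> [Ei Es Et] [Ej Es' Et']; have Eij : j0 = i0 by lia.
  have /term_plus_inj E : term_plus s0 = term_plus s0' by rewrite Es.
  by subst; apply: lt_right; apply: IHt.
- move=> i s t s' t' _ IHt [|i0 s0 t0] // [|j0 s0' t0'] //.
  move=> [Ei Es Et] [Ej Es' Et']; have Eij : j0 = i0 by lia.
  by subst; apply: lt_sub; apply: IHt.
- move=> i s t s' t' E [|i0 s0 t0] // [|j0 s0' t0'] //.
  move=> [Ei Es Et] [Ej Es' Et']; have Eij : j0 = i0 by lia.
  by subst; apply: lt_sub_eq; apply: term_plus_inj.
Qed.

(** A node [theta 0] would put itself into [term_K 0 s]; so every index is positive and can be
    lowered by one. *)
Lemma term_plus_surj (n : nat) (s : term) : in_OT n.+1 s ->
  term_K 0 s == fset0 -> exists2 u, in_OT n u & s = term_plus u.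
Proof.
elim: s => [|i s IHs t IHt]; first by exists zero_term.
case: i => [|i] /=.
  by move=> _ /eqP/fsetP/(_ (theta 0 s t)); rewrite !inE eqxx.
move=> /and5P[Hs Ht Hi HS HK]; rewrite fsetU_eq0_term => /andP[Ks Kt].
have [u Hu Es] := IHs Hs Ks; have [v Hv Et] := IHt Ht Kt; subst s t.
exists (theta i u v) => //=; rewrite Hu Hv -(term_K_plus i u).
have -> : (i%:Z + 1 = i.+1%:Z)%R by lia.
rewrite HK andbT /=; move: Hi HS.
(* The shift raises [term_S] by one except at [zero_term], where it stays -1; hence the case
   split. *)
by case: u {IHs Hs Hu HK Ks} => [|k u1 u2]; case: v {IHt Ht Hv Kt} => [|l v1 v2] /=; lia.
Qed.

(** At index 0 the side conditions bound [term_S s] by 1 and [term_S t] by 0 and make [term_K 0 s]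
    empty. So [s] is the shift of an element of [OT0 n], and [t] stays in [OT0 n.+1]. *)
Lemma OT0_ind (n : nat) (P : OT0 n.+1 -> Prop) : P (OT0_zero n.+1) ->
  (forall (s : OT0 n) (t : OT0 n.+1), P t -> P (theta0_plus s t)) ->
  forall r, P r.
Proof.
move=> P0 Pth [[r Hr] Sr]; elim: r Hr Sr => [|i s _ t IHt] Hr Sr.
  by rewrite (_ : exist _ _ _ = OT0_zero n.+1) //; do 2!apply: val_inj.
have i0 : i = 0 by move: Sr => /=; lia.
subst i; have /= /and4P[Hs Ht HS HK] := Hr.
have [u Hu Es] := @term_plus_surj n _ Hs HK; subst s.
have Su : (term_S u <= 0)%R by move: HS; case: (u) => /= *; lia.
have St : (term_S t <= 0)%R by lia.
pose s0 : OT0 n := exist _ (exist _ u Hu : OT n) Su.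
pose t0 : OT0 n.+1 := exist _ (exist _ t Ht : OT n.+1) St.
rewrite (_ : exist _ _ _ = theta0_plus s0 t0); first exact/Pth/IHt.
by do 2!apply: val_inj.
Qed.

Lemma OT0_vartheta_BH (n : nat) :
  @BH_fixed_point (D_dilator n) LO_empty (OT0_LO n.+1)
    (@OT0_iota n) (@OT0_vartheta n).
Proof.
split; [by case | by case | |].
- case=> [[s x]|] [[s' x']|] //= L Hsupp; last exact: lt_zero.
  case: L => [/term_lt_plus L|[-> L]]; last exact: lt_right.
  exact/lt_left/(Hsupp x).
- by case=> [[s x]|] z //= ->; apply: term_lt_arg (in_OT_theta0_plus s x).
Qed.

Section InitialMap.
Variables (n : nat) (Z : LO) (v : D_dilator n Z -> Z).

(** Working on raw terms keeps the recursion structural. [xget] inverts the shift; its default value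
    only serves terms outside [OT0 n.+1]. *)
Fixpoint term_fold (r : term) : Z :=
  match r with
  | zero_term => v None
  | theta _ s t =>
      v (Some (xget (OT0_zero n) [set u | term_plus (val (val u)) = s]%classic,
               term_fold t))
  end.

Lemma term_fold_theta0 (s : OT0 n) (t : term) :
  term_fold (theta 0 (term_plus (val (val s))) t) = v (Some (s, term_fold t)).
Proof.
move=> /=; congr (v (Some (_, _))); case: xgetP => [u _ /term_plus_inj E|].
  by do 2!apply: val_inj.
by move=> /(_ s) /(_ erefl).
Qed.

Definition OT0_fold (r : OT0_LO n.+1) : Z := term_fold (val (val r)).

Lemma OT0_fold_vartheta (sigma : D_dilator n (OT0_LO n.+1)) :
  OT0_fold (OT0_vartheta sigma) = v (D_fun OT0_fold sigma).
Proof. by case: sigma => [[s t]|] //; apply: term_fold_theta0. Qed.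

Hypothesis v_mono : forall sigma tau : D_dilator n Z, sigma <_LO tau ->
  (forall z : Z, dil_supp sigma z -> z <_LO v tau) -> v sigma <_LO v tau.
Hypothesis v_supp_lt : forall (sigma : D_dilator n Z) (z : Z),
  dil_supp sigma z -> z <_LO v sigma.

(** Induction on the derivation, not on the terms: for [lt_left] it gives the hypothesis for [t]
    against the whole of [r'], which is the support condition in [v_mono]. *)
Lemma OT0_fold_mono (r r' : OT0_LO n.+1) :
  r <_LO r' -> OT0_fold r <_LO OT0_fold r'.
Proof.
have tr : Transitive (@LO_lt Z) by case: (LO_strict Z).
have fold_th s t :
    OT0_fold (theta0_plus s t) = v (Some (s, OT0_fold t)).
  exact: (OT0_fold_vartheta (Some (s, t))).
have arg s t : OT0_fold t <_LO OT0_fold (theta0_plus s t).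
  by rewrite fold_th; apply: v_supp_lt.
rewrite /= /OT0_lt /OT_lt.
move Eu: (val (val r)) => u; move Eu': (val (val r')) => u' L.
elim: L r r' Eu Eu' => {u u'}.
- move=> u' nz r r' Eu Eu'.
  elim/OT0_ind: r Eu => [_|//]; elim/OT0_ind: r' Eu' => [/esym//|s t _ _].
  by rewrite fold_th; apply: v_mono.
(* Vacuous, since both indices are 0 in [OT0 n.+1]. *)
- move=> i s t j s' t' ltij r r' Eu Eu'; move: (valP r) (valP r').
  by rewrite Eu Eu' /=; lia.
- move=> i s t s' t' lts _ _ IHt r r' Eu Eu'.
  elim/OT0_ind: r Eu => [//|s0 t0 _ [_ Es Et]].
  elim/OT0_ind: r' Eu' => [//|s0' t0' _ [Ei Es' Et']].
  rewrite !fold_th; apply: v_mono => [|_ /= ->].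
    by left; apply: term_lt_plus_inv; rewrite Es Es'.
  by rewrite -fold_th; apply: IHt => //=; rewrite Es' Et' Ei.
- move=> i s t t' _ IHt r r' Eu Eu'.
  elim/OT0_ind: r Eu => [//|s0 t0 _ [_ Es Et]].
  elim/OT0_ind: r' Eu' => [//|s0' t0' _ [_ Es' Et']].
  have <- : s0 = s0'.
    by do 2!apply: val_inj; apply: term_plus_inj; rewrite Es.
  have lt_t : OT0_fold t0 <_LO OT0_fold t0' by apply: IHt.
  rewrite !fold_th; apply: v_mono => [|_ /= ->]; first by right.
  (* Here the support condition is reached through the image of [t0'], which lies below that of
     [r']. *)
  by rewrite -fold_th; apply: tr lt_t (arg _ _).
- move=> i s t s' t' _ IHt r r' Eu Eu'.
  elim/OT0_ind: r' Eu' => [//|s0' t0' _ [_ _ Et']].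
  by apply: tr (arg _ _); apply: IHt.
- move=> i s t s' t' E r r' Eu Eu'.
  elim/OT0_ind: r' Eu' => [//|s0' t0' _ [_ _ Et']].
  have -> : r = t0' by do 2!apply: val_inj; rewrite Eu E.
  exact: arg.
Qed.

Lemma OT0_fold_embedding : order_embedding OT0_fold.
Proof.
have [irr tr] := LO_strict Z => r r'; split; first exact: OT0_fold_mono.
move=> L; have [//|[E|/OT0_fold_mono L']] := LO_total r r'.
- by move: L; rewrite E => /irr.
- by case: (irr (OT0_fold r)); apply: tr L L'.
Qed.

End InitialMap.

Lemma LO_mor_eq (X Y : LO) (f g : LO_mor X Y) : f =1 g -> f = g.
Proof.
case: f g => [f Hf] [g Hg] /= /funext E; subst g.
by rewrite (Prop_irrelevance Hf Hg).
Qed.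

Theorem theorem5p19 (n : nat) :
  @initial_BH_fixed_point (D_dilator n) LO_empty (OT0_LO n.+1)
    (@OT0_iota n) (@OT0_vartheta n).
Proof.
split=> [|Z iota v [_ _ v_mono v_supp_lt]]; first exact: OT0_vartheta_BH.
exists (MkLOMor (@OT0_fold_embedding n Z v v_mono v_supp_lt)); split.
  split; apply/funext; first by case.
  by move=> sigma; apply: OT0_fold_vartheta.
(* Commuting with [OT0_vartheta] is the recursion equation of the fold, so [OT0_ind] yields
   uniqueness. *)
move=> g [_ Hg]; apply: LO_mor_eq => r /=.
have g_th sigma : g (OT0_vartheta sigma) = v (D_fun g sigma).
  by have := congr1 (fun h => h sigma) Hg.
elim/OT0_ind: r => [|s t IHt]; first by rewrite (g_th None).
by rewrite (OT0_fold_vartheta v (Some (s, t))) (g_th (Some (s, t))) /= IHt.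
Qed.
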